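(* Let $f\in K[[X]][y]$ be a monic polynomial, let $\preceq$ be an additive total order on $\mathbb{R}^n$ compatible with the first orthant, and let $\mathcal{A}\subset K_{\preceq}((X))$ be a subring. If $\xi$ and $\xi'$ are roots of $f$ in $K_{\preceq}((X^* ))$ that belong to the same $\preceq$-branch of $f$, then $\Gamma^{\preceq}_{\xi,\mathcal{A}}=\Gamma^{\preceq}_{\xi',\mathcal{A}}$.
   Context: $K$ is an algebraically closed field of characteristic zero, $n\ge 1$, and $X=(x_1,\dots,x_n)$. $\preceq$ is an additive total order on $\mathbb{R}^n$ (total order compatible with the group structure) that is compatible with the first orthant, i.e. $(\mathbb{R}_{\ge 0})^n\subset(\mathbb{R}^n)_{\succeq\underline{0}}:=\{u\in\mathbb{R}^n ; \underline{0}\preceq u\}$. A cone is a set $\sigma=\{\lambda_1u_1+\dots+\lambda_su_s ; \lambda_i\in\mathbb{R}_{\ge0}\}$ with $u_1,\dots,u_s\in\mathbb{Q}^n$; it is compatible with $\preceq$ when $\sigma\subset(\mathbb{R}^n)_{\succeq\underline{0}}$. For such $\sigma$, $K_\sigma[[X]]$ is the ring of formal series $\sum_{\gamma\in\sigma\cap\mathbb{Z}^n}a_\gamma X^\gamma$, $a_\gamma\in K$. For $k\in\mathbb{Z}_{\ge1}$, $K_\sigma[[X^{1/k}]]$ is the analogous ring of series with exponents in $\sigma\cap\frac1k\mathbb{Z}^n$. Put $K_\preceq[[X]]=\bigcup_{\sigma\subset(\mathbb{R}^n)_{\succeq\underline0}}K_\sigma[[X]]$, $K_\preceq[[X^{1/k}]]=\bigcup_{\sigma\subset(\mathbb{R}^n)_{\succeq\underline0}}K_\sigma[[X^{1/k}]]$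 and $K_\preceq[[X^*]]=\bigcup_{k\ge1}K_\preceq[[X^{1/k}]]$ (unions over compatible cones). Their fields of fractions are, respectively, $K_\preceq((X))=\{\varphi ; \exists\gamma\in\mathbb{Z}^n,\ X^\gamma\varphi\in K_\preceq[[X]]\}$, $K_\preceq((X^{1/k}))=\{\varphi ; \exists\gamma\in\mathbb{Z}^n,\ X^{\gamma/k}\varphi\in K_\preceq[[X^{1/k}]]\}$ and $K_\preceq((X^* ))=\bigcup_{k\ge1}K_\preceq((X^{1/k}))$. The field $K_\preceq((X^* ))$ is algebraically closed, and $K[[X]]\subset K_\preceq[[X]]$. For $\varphi=\sum a_\gamma X^\gamma\neq0$ in $K_\preceq((X^* ))$, $Supp(\varphi)=\{\gamma ; a_\gamma\ne0\}$ and $\nu_\preceq(\varphi):=\min_\preceq Supp(\varphi)\in\mathbb{Q}^n$. For $\xi\in K_\preceq((X^* ))$ and a subring $\mathcal{A}\subset K_\preceq((X))$, $\Gamma^\preceq_{\xi,\mathcal{A}}:=\{\nu_\preceq(h(\xi)) ; h\in\mathcal{A}[y]\setminus(y-\xi)\}\subset\mathbb{Q}^n$, where $(y-\xi)$ is the ideal of $K_\preceq((X^* ))[y]$ generated by $y-\xi$ (so $h$ runs over elements of $\mathcal{A}[y]$ with $h(\xi)\ne0$). A $\preceq$-branch of $f$ is the set of roots in $K_\preceq[[X^*]]$ of an irreducible element $g\in K_\preceq[[X]][y]$ that divides $f$ in $K_\preceq[[X]][y]$. (All roots in $K_\preceq((X^* ))$ of a monic polynomial of $K[[X]][y]$ lie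 in $K_\preceq[[X^*]]$.) *)

(* Defs.v *)
From HB Require Import structures.
From mathcomp Require Import all_boot all_order all_algebra.
From mathcomp Require Import finmap.
From mathcomp Require Import mathcomp_extra boolp classical_sets functions.
From mathcomp Require Import cardinality fsbigop reals.

Set Implicit Arguments.
Unset Strict Implicit.
Unset Printing Implicit Defensive.
Import Order.TTheory GRing.Theory Num.Theory.
Local Open Scope classical_set_scope.
Local Open Scope ring_scope.

(* Compatibility with multiplication by real scalars is not required: only the
   group structure of R^n is involved.  *)
Record orthant_order (R : realType) (n : nat) := OrthantOrder {
  ole :> rel 'rV[R]_n;
  ole_refl : reflexive ole;
  ole_anti : antisymmetric ole;
  ole_trans : transitive ole;
  ole_total : total ole;
  ole_add : forall u v w, ole u v -> ole (u + w) (v + w);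
  ole_orthant : forall u : 'rV[R]_n, (forall i, 0 <= u ord0 i) -> ole 0 u
}.

Section Cones.
Variables (R : realType) (n : nat).

Definition rvR (u : 'rV[rat]_n) : 'rV[R]_n := map_mx (ratr : rat -> R) u.

Definition cone (s : nat) (u : 'I_s -> 'rV[rat]_n) : set 'rV[R]_n :=
  [set v | exists2 l : 'I_s -> R,
     (forall i, 0 <= l i) & v = \sum_i l i *: rvR (u i)].

Definition is_cone (sigma : set 'rV[R]_n) : Prop :=
  exists (s : nat) (u : 'I_s -> 'rV[rat]_n), sigma = cone u.

Definition compatible (le : orthant_order R n) (sigma : set 'rV[R]_n) : Prop :=
  sigma `<=` [set u | le 0 u].

End Cones.

(* (1/k) Z^n inside Q^n, for k > 0 *)
Definition lattice {n : nat} (k : nat) : set 'rV[rat]_n :=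
  [set k%:R^-1 *: map_mx intr m | m in [set: 'rV[int]_n]].

Section Series.
Variables (K : fieldType) (R : realType) (n : nat) (le : orthant_order R n).

(* A formal series sum a_g X^g is its family of coefficients a : Q^n -> K. *)
Definition supp (a : 'rV[rat]_n -> K) : set 'rV[rat]_n := [set g | a g != 0].

(* multiplication by the monomial X^d *)
Definition mulX (d : 'rV[rat]_n) (a : 'rV[rat]_n -> K) : 'rV[rat]_n -> K :=
  fun g => a (g - d).

(* K_sigma[[X^(1/k)]] *)
Definition Ksigma (k : nat) (sigma : set 'rV[R]_n) : set ('rV[rat]_n -> K) :=
  [set a | supp a `<=` [set g | sigma (rvR R g) /\ lattice k g]].

(* K_le[[X^(1/k)]] *)
Definition Kle (k : nat) : set ('rV[rat]_n -> K) :=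
  [set a | exists sigma : set 'rV[R]_n,
     [/\ is_cone sigma, compatible le sigma & Ksigma k sigma a]].

(* K_le[[X^*]] *)
Definition Kle_star : set ('rV[rat]_n -> K) :=
  [set a | exists k : nat, (0 < k)%N /\ Kle k a].

(* K_le((X^(1/k))) *)
Definition Kfrac (k : nat) : set ('rV[rat]_n -> K) :=
  [set a | exists m : 'rV[int]_n,
     Kle k (mulX (k%:R^-1 *: map_mx intr m) a)].

(* K_le((X^* )) *)
Definition Kfrac_star : set ('rV[rat]_n -> K) :=
  [set a | exists k : nat, (0 < k)%N /\ Kfrac k a].

(* K[[X]] *)
Definition Kpow : set ('rV[rat]_n -> K) :=
  [set a | supp a `<=` [set g | lattice 1 g /\ forall i, 0 <= g ord0 i]].

Definition mulS (a b : 'rV[rat]_n -> K) : 'rV[rat]_n -> K :=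
  fun g => \sum_(d \in [set: 'rV[rat]_n]) a d * b (g - d).

Definition constS (c : K) : 'rV[rat]_n -> K := fun g => if g == 0 then c else 0.

End Series.

Section OrderTheory.
Variables (R : realType) (n : nat) (le : orthant_order R n).
Implicit Types (u v : 'rV[rat]_n) (S T : set 'rV[rat]_n).
Local Notation rvR := (@rvR R n).

Lemma rvRD u v : rvR (u + v) = rvR u + rvR v. Proof. exact: map_mxD. Qed.
Lemma rvRN u : rvR (- u) = - rvR u. Proof. exact: map_mxN. Qed.
Lemma rvR0 : rvR 0 = 0. Proof. exact: map_mx0. Qed.
Lemma rvRZ c u : rvR (c *: u) = ratr c *: rvR u. Proof. exact: map_mxZ. Qed.
Lemma rvRMn u m : rvR (u *+ m) = rvR u *+ m.
Proof. by elim: m => [|m IH]; rewrite ?rvR0 // !mulrS rvRD IH. Qed.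
Lemma rvR_sum (I : Type) (r : seq I) (F : I -> 'rV[rat]_n) :
  rvR (\sum_(i <- r) F i) = \sum_(i <- r) rvR (F i).
Proof. exact: (big_morph _ rvRD rvR0). Qed.
Lemma rvR_inj : injective rvR.
Proof. by move=> u v /matrixP E; apply/matrixP => i j; have := E i j;
  rewrite !mxE => /fmorph_inj. Qed.

Definition leQ u v : bool := le (rvR u) (rvR v).

Lemma leQ_refl u : leQ u u. Proof. exact: ole_refl. Qed.
Lemma leQ_trans v u w : leQ u v -> leQ v w -> leQ u w.
Proof. exact: ole_trans. Qed.
Lemma leQ_anti u v : leQ u v -> leQ v u -> u = v.
Proof. by move=> h1 h2; apply/rvR_inj/(@ole_anti _ _ le)/andP. Qed.
Lemma leQ_total u v : leQ u v || leQ v u. Proof. exact: ole_total. Qed.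
Lemma leQ_add u v w : leQ u v -> leQ (u + w) (v + w).
Proof. by rewrite /leQ !rvRD; exact: ole_add. Qed.
Lemma leQ_add2 u v u' v' : leQ u v -> leQ u' v' -> leQ (u + u') (v + v').
Proof.
move=> h h'; apply: (leQ_trans (leQ_add u' h)).
by rewrite ![v + _]addrC; exact: leQ_add.
Qed.
Lemma leQ_subr u v w : leQ u v -> leQ (w - v) (w - u).
Proof.
by move/(leQ_add (w - u - v)); rewrite !(addrC _ (w - _ - _)) addrNK addrAC addrNK.
Qed.
Lemma leQ_muln u m : leQ 0 u -> leQ 0 (u *+ m).
Proof.
move=> h; elim: m => [|m IH]; first exact: leQ_refl.
by rewrite mulrS -[0]addr0; exact: leQ_add2.
Qed.
Lemma le_add_nneg (x y : 'rV[R]_n) : le 0 x -> le 0 y -> le 0 (x + y).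
Proof.
by move=> hx /(ole_add x); rewrite add0r addrC; exact: ole_trans.
Qed.

Definition well_ordered S : Prop := forall T, T `<=` S -> T !=set0 ->
  exists2 x, T x & forall y, T y -> leQ x y.

Lemma wo_sub S T : S `<=` T -> well_ordered T -> well_ordered S.
Proof. by move=> ST wT A AS; apply: wT => x /AS /ST. Qed.

Lemma wo_seq (s : seq 'rV[rat]_n) : well_ordered [set` s].
Proof.
elim: s => [|a s IH] T Ts [x Tx]; first by have := Ts _ Tx.
have [T0|/set0P T0] := eqVneq (T `&` [set` s]) set0.
  have Ta : T `<=` [set a].
    move=> y Ty; have := Ts _ Ty; rewrite /= inE => /orP[/eqP //|ys].
    by have : (T `&` [set` s]) y by []; rewrite T0.
  by exists x => // y /Ta ->; rewrite (Ta _ Tx); exact: leQ_refl.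
have [|y [Ty _] ymin] := IH (T `&` [set` s]) _ T0; first by move=> ? [].
have [Ta|Ta] := pselect (T a); last first.
  exists y => // z Tz; have := Ts _ Tz; rewrite /= inE => /orP[/eqP za|zs].
    by case: Ta; rewrite -za.
  exact: ymin.
have /orP[h|h] := leQ_total a y.
- exists a => // z Tz; have := Ts _ Tz; rewrite /= inE => /orP[/eqP->|zs].
    exact: leQ_refl.
  by apply: (leQ_trans h); apply: ymin.
- exists y => // z Tz; have := Ts _ Tz; rewrite /= inE => /orP[/eqP->//|zs].
  exact: ymin.
Qed.

Lemma wo_finite S : finite_set S -> well_ordered S.
Proof.
move=> fS; have /finite_fsetP[X ->] := fS; exact: (@wo_seq (enum_fset X)).
Qed.

Definition addN S u : set 'rV[rat]_n :=
  [set x | exists a m, S a /\ x = a + u *+ m].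

Lemma wo_addN S u : leQ 0 u -> well_ordered S -> well_ordered (addN S u).
Proof.
move=> u0 wS T TS T0.
pose A m := [set a | S a /\ T (a + u *+ m)].
have [||a0 [m0 [Sa0 Ta0]] a0min] := wS [set a | exists m, A m a].
- by move=> a [m []].
- by case: T0 => x Tx; have [a [m [Sa xE]]] := TS _ Tx; exists a, m;
    split=> //; rewrite -xE.
(* minimum over the elements with fewer than m copies of u *)
have low m : (exists x, [/\ T x, (exists a p, [/\ S a, (p < m)%N & x = a + u *+ p])
    & forall a p, S a -> (p < m)%N -> T (a + u *+ p) -> leQ x (a + u *+ p)])
  \/ (forall a p, S a -> (p < m)%N -> ~ T (a + u *+ p)).
  elim: m => [|m IH]; first by right.
  have [Am0|/set0P Am0] := eqVneq (A m) set0.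
    have nA a : S a -> ~ T (a + u *+ m).
      by move=> Sa Ta; have : A m a by []; rewrite Am0.
    case: IH => [[x [Tx [a [p [Sa pm xE]]] xmin]]|IH]; [left|right].
      exists x; split=> //; first by exists a, p; split=> //; apply: ltnW.
      move=> b q Sb; rewrite ltnS leq_eqVlt => /orP[/eqP->|]; last exact: xmin.
      by move/(nA _ Sb).
    move=> b q Sb; rewrite ltnS leq_eqVlt => /orP[/eqP->|]; last exact: IH.
    exact: nA.
  have [|b [Sb Tb] bmin] := wS (A m) _ Am0; first by move=> ? [].
  left; case: IH => [[x [Tx [a [p [Sa pm xE]]] xmin]]|IH].
    have /orP[h|h] := leQ_total x (b + u *+ m).
      exists x; split=> //; first by exists a, p; split=> //; apply: ltnW.
      move=> c q Sc; rewrite ltnS leq_eqVlt => /orP[/eqP-> Tc|]; last exact: xmin.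
      by apply: (leQ_trans h); apply: leQ_add; apply: bmin.
    exists (b + u *+ m); split=> //; first by exists b, m.
    move=> c q Sc; rewrite ltnS leq_eqVlt => /orP[/eqP-> Tc|qm Tc].
      by apply: leQ_add; apply: bmin.
    by apply: (leQ_trans h); apply: xmin.
  exists (b + u *+ m); split=> //; first by exists b, m.
  move=> c q Sc; rewrite ltnS leq_eqVlt => /orP[/eqP-> Tc|qm Tc].
    by apply: leQ_add; apply: bmin.
  by case: (IH _ _ Sc qm Tc).
have high a p : S a -> (m0 <= p)%N -> T (a + u *+ p) -> leQ (a0 + u *+ m0) (a + u *+ p).
  move=> Sa mp Ta; rewrite -(subnKC mp) mulrnDr [a + _]addrA -[a0 + _]addr0.
  apply: leQ_add2 (leQ_muln _ u0).
  by apply: leQ_add; apply: a0min; exists p.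
have [[x [Tx _ xmin]]|none] := low m0; last first.
  exists (a0 + u *+ m0) => // y Ty; have [a [p [Sa yE]]] := TS _ Ty.
  rewrite yE in Ty *; have [mp|pm] := leqP m0 p; first exact: high.
  by case: (none _ _ Sa pm Ty).
have /orP[h|h] := leQ_total x (a0 + u *+ m0).
- exists x => // y Ty; have [a [p [Sa yE]]] := TS _ Ty.
  rewrite yE in Ty *; have [mp|pm] := leqP m0 p; last exact: xmin.
  by apply: (leQ_trans h); apply: high.
- exists (a0 + u *+ m0) => // y Ty; have [a [p [Sa yE]]] := TS _ Ty.
  rewrite yE in Ty *; have [mp|pm] := leqP m0 p; first exact: high.
  by apply: (leQ_trans h); apply: xmin.
Qed.

Lemma wo_sum (I : eqType) (r : seq I) (U : I -> 'rV[rat]_n) S :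
  (forall i, leQ 0 (U i)) -> well_ordered S ->
  well_ordered [set x | exists a (m : I -> nat),
     S a /\ x = a + \sum_(i <- r) U i *+ m i].
Proof.
move=> U0 wS; elim: r => [|i r IH].
  apply: (wo_sub _ wS) => x [a [m [Sa ->]]]; by rewrite big_nil addr0.
apply: (wo_sub _ (wo_addN (U0 i) IH)) => x [a [m [Sa ->]]].
exists (a + \sum_(j <- r) U j *+ m j), (m i); split; first by exists a, m.
by rewrite big_cons -addrA [U i *+ _ + _]addrC.
Qed.

(* A set whose nonempty subsets all have a minimum and a maximum is finite. *)
Lemma wo_wo_finite S (g : 'rV[rat]_n) : well_ordered S ->
  well_ordered [set g - x | x in S] -> finite_set S.
Proof.
move=> wS wS'.
have maxS T : T `<=` S -> T !=set0 -> exists2 x, T x & forall y, T y -> leQ y x.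
  move=> TS T0; have [||_ [x Tx <-] xmin] := wS' [set g - x | x in T].
  - by move=> _ [x Tx <-]; exists x => //; apply: TS.
  - by case: T0 => x Tx; exists (g - x), x.
  exists x => // y Ty; have := xmin (g - y) (ex_intro2 _ _ _ Ty erefl).
  by move/(leQ_subr g); rewrite !subKr.
pose I x := [set y | S y /\ leQ y x].
have [S0|/set0P S0] := eqVneq S set0; first by rewrite S0; exact: finite_set0.
have allI x : S x -> finite_set (I x).
  move=> Sx; apply: contrapT => nfx.
  have [||c [Sc nfc] cmin] := wS [set c | S c /\ ~ finite_set (I c)].
  - by move=> ? [].
  - by exists x.
  apply: nfc; pose L := [set y | S y /\ leQ y c /\ y <> c].
  have [L0|/set0P L0] := eqVneq L set0.
    apply: (@sub_finite_set _ _ [set c]); last exact: finite_set1.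
    move=> y [Sy yc] /=; apply: contrapT => yNc.
    by have : L y by []; rewrite L0.
  have [|d [Sd [dc dNc]] dmax] := maxS L _ L0; first by move=> ? [].
  have fd : finite_set (I d).
    by apply: contrapT => nfd; apply: dNc; apply: leQ_anti => //; apply: cmin.
  apply: (@sub_finite_set _ _ (I d `|` [set c])); last first.
    by rewrite finite_setU; split=> //; exact: finite_set1.
  move=> y [Sy yc]; have [->|/eqP yNc] := eqVneq y c; first by right.
  by left; split=> //; apply: dmax.
have [|m Sm mmax] := maxS S _ S0; first by [].
apply: sub_finite_set (allI _ Sm) => y Sy; split=> //; exact: mmax.
Qed.

Lemma lattice_mul k l u : (0 < l)%N -> lattice k u -> lattice (k * l) u.
Proof.
move=> l0 [m _ <-]; exists (l%:Z *: m) => //; apply/matrixP => i j.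
rewrite !mxE intrM natrM invfM mulrACA -mulrA pmulrn.
by rewrite mulVKf // intr_eq0 -lt0n.
Qed.

Lemma latticeD k u v : lattice k u -> lattice k v -> lattice k (u + v).
Proof.
by move=> [m _ <-] [p _ <-]; exists (m + p) => //; rewrite map_mxD scalerDr.
Qed.

Lemma latticeN k u : lattice k u -> lattice k (- u).
Proof. by move=> [m _ <-]; exists (- m) => //; rewrite map_mxN scalerN. Qed.

Lemma lattice0 k : lattice k (0 : 'rV[rat]_n).
Proof. by exists 0 => //; rewrite map_mx0 scaler0. Qed.

Lemma latticeMn k u m : lattice k u -> lattice k (u *+ m).
Proof.
move=> h; elim: m => [|m IH]; first exact: lattice0.
by rewrite mulrS; exact: latticeD.
Qed.

Lemma lattice_sum k (I : Type) (r : seq I) (F : I -> 'rV[rat]_n) :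
  (forall i, lattice k (F i)) -> lattice k (\sum_(i <- r) F i).
Proof.
move=> h; elim: r => [|i r IH]; rewrite ?big_nil ?big_cons; first exact: lattice0.
exact: latticeD.
Qed.

Lemma lattice_box_finite k (B : rat) : (0 < k)%N ->
  finite_set [set u : 'rV[rat]_n | lattice k u /\ forall j, `|u ord0 j| <= B].
Proof.
move=> k0; pose C := (Num.truncn (k%:R * B)).+1.
pose f (m : {ffun 'I_n -> 'I_(C + C).+1}) : 'rV[rat]_n :=
  k%:R^-1 *: map_mx intr (\row_j ((m j : nat)%:Z - C%:Z)).
apply: (@sub_finite_set _ _ (f @` setT)); last exact/finite_image/finite_finset.
move=> _ [[m _ <-]] mB.
have mC j : `|m ord0 j| <= C%:Z.
  have := mB j; rewrite !mxE normrM normfV normr_nat.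
  rewrite ler_pdivrMl ?ltr0n // => h.
  rewrite -(ler_int rat) intr_norm (le_trans h) // ltW // pmulrn -pmulrn.
  exact: truncnS_gt.
exists [ffun j => inord (absz (m ord0 j + C%:Z))] => //.
rewrite /f; congr (_ *: map_mx _ _); apply/rowP => j; rewrite !mxE ffunE.
have := mC j; rewrite ler_norml => /andP[h1 h2].
have h0 : 0 <= m ord0 j + C%:Z by rewrite -lerBlDr sub0r.
rewrite inordK; first by rewrite gez0_abs // addrK.
by rewrite ltnS -lez_nat gez0_abs // PoszD lerD2r.
Qed.

Lemma wo_cone_lattice k (sigma : set 'rV[R]_n) : (0 < k)%N ->
  is_cone sigma -> compatible le sigma ->
  well_ordered [set u | sigma (rvR u) /\ lattice k u].
Proof.
move=> k0 [s [u ->]] csig.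
pose N : int := \prod_(i < s) \prod_(j < n) denq (u i ord0 j).
have N0 : 0 < N by apply: prodr_gt0 => i _; apply: prodr_gt0 => j _; exact: denq_gt0.
pose U i : 'rV[rat]_n := N%:~R *: u i.
have U1 i : lattice 1 (U i).
  have denP j : exists z : int, N%:~R * u i ord0 j = z%:~R.
    rewrite /N (bigD1 i) //= (bigD1 j) //=.
    set P1 := \prod_(_ | _) _; set P2 := \prod_(_ | _) _.
    exists (numq (u i ord0 j) * P1 * P2); rewrite !intrM numqE.
    by rewrite mulrC !mulrA.
  have [z zE] := choice denP.
  exists (\row_j z j) => //; rewrite invr1 scale1r; apply/rowP => j.
  by rewrite !mxE -zE.
have Uk i : lattice k (U i) by rewrite -[k]mul1n; exact: lattice_mul.
have NR0 : 0 < (N%:~R : R) by rewrite ltr0z.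
have Ucone i : cone u (rvR (U i)).
  exists (fun j => if j == i then N%:~R else 0).
    by move=> j; case: ifP => // _; exact: ltW.
  rewrite (bigD1 i) //= eqxx big1 ?addr0 ?rvRZ ?ratr_int //.
  by move=> j /negbTE ->; rewrite scale0r.
have U0 i : leQ 0 (U i) by rewrite /leQ rvR0; apply: csig.
pose B : rat := \sum_i \sum_j `|U i ord0 j|.
have := wo_sum (r := index_enum 'I_s) U0 (wo_finite (lattice_box_finite B k0)).
apply: wo_sub => g [[l l0 gE] gk].
pose mu i := l i / N%:~R.
have mu0 i : 0 <= mu i by rewrite divr_ge0 // ltW.
pose m i := Num.truncn (mu i).
have gE' : rvR g = \sum_i mu i *: rvR (U i).
  rewrite gE; apply: eq_bigr => i _; rewrite rvRZ ratr_int scalerA.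
  by rewrite divfK // gt_eqF.
exists (g - \sum_i U i *+ m i), m; split; last by rewrite subrK.
split; first by apply/latticeD/latticeN/lattice_sum => // i; exact: latticeMn.
move=> j; rewrite -(ler_rat R).
have -> : ratr `|(g - \sum_i U i *+ m i) ord0 j| =
    `|\sum_i (mu i - (m i)%:R) * ratr (U i ord0 j)| :> R.
  have : rvR (g - \sum_i U i *+ m i) = \sum_i (mu i - (m i)%:R) *: rvR (U i).
    rewrite rvRD rvRN rvR_sum gE' -sumrB; apply: eq_bigr => i _.
    by rewrite rvRMn scalerBl scaler_nat.
  move/rowP/(_ j); rewrite mxE ratr_norm => ->.
  by rewrite summxE; congr `|_|; apply: eq_bigr => i _; rewrite !mxE.
rewrite /B rmorph_sum /=; apply: (le_trans (ler_norm_sum _ _ _)).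
apply: ler_sum => i _; rewrite normrM.
apply: (@le_trans _ _ (1 * `|ratr (U i ord0 j)|)).
  apply: ler_wpM2r => //; have /andP[h1 h2] := truncn_itv (mu0 i).
  rewrite ger0_norm ?subr_ge0 // lerBlDl -natr1 in h2 *; exact: ltW.
rewrite mul1r -ratr_norm ler_rat (bigD1 j) //= lerDl.
exact: sumr_ge0.
Qed.

End OrderTheory.

Section LatticeSets.
Variables (R : realType) (n : nat) (le : orthant_order R n).
Implicit Types (S T : set 'rV[rat]_n) (m p : 'rV[int]_n).
Local Notation rvR := (@rvR R n).
Local Notation well_ordered := (well_ordered le).

Definition shiftq k m : 'rV[rat]_n := k%:R^-1 *: map_mx intr m.

Definition rep k m S : Prop := exists sigma : set 'rV[R]_n,
  [/\ is_cone sigma, compatible le sigma &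
   forall g, S g -> sigma (rvR (g + shiftq k m)) /\ lattice k (g + shiftq k m)].

(* the supports of the elements of K_le((X^* )) *)
Definition lpset S : Prop := exists k m, (0 < k)%N /\ rep k m S.

Lemma lpset_sub S T : S `<=` T -> lpset T -> lpset S.
Proof.
move=> ST [k [m [k0 [sg [h1 h2 h3]]]]]; exists k, m; split=> //.
by exists sg; split=> // g /ST /h3.
Qed.

Lemma wo_image_add S d : well_ordered [set x + d | x in S] -> well_ordered S.
Proof.
move=> w T TS [x Tx]; have [||_ [y Ty <-] ymin] := w [set x + d | x in T].
- by move=> _ [z Tz <-]; exists z => //; apply: TS.
- by exists (x + d), x.
exists y => // z Tz; have := ymin (z + d) (ex_intro2 _ _ _ Tz erefl).
by move/(leQ_add (- d)); rewrite !addrK.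
Qed.

Lemma lpset_wo S : lpset S -> well_ordered S.
Proof.
move=> [k [m [k0 [sg [h1 h2 h3]]]]]; apply: (@wo_image_add _ (shiftq k m)).
apply: wo_sub (wo_cone_lattice k0 h1 h2) => _ [g Sg <-]; exact: h3.
Qed.

Lemma cone0 s (u : 'I_s -> 'rV[rat]_n) : @cone R n s u 0.
Proof. by exists (fun=> 0) => //; rewrite big1 // => i _; rewrite scale0r. Qed.

Lemma is_coneD (sg1 sg2 : set 'rV[R]_n) : is_cone sg1 -> is_cone sg2 ->
  is_cone [set v | exists x y, [/\ sg1 x, sg2 y & v = x + y]].
Proof.
move=> [s [u ->]] [t [w ->]].
pose U (i : 'I_(s + t)) := match fintype.split i with inl j => u j | inr j => w j end.
exists (s + t)%N, U; apply/seteqP; split=> v.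
  move=> [x [y [[l l0 xE] [l' l'0 yE] ->]]].
  exists (fun i => match fintype.split i with inl j => l j | inr j => l' j end).
    by move=> i; case: fintype.split.
  rewrite big_split_ord xE yE /=; congr (_ + _); apply: eq_bigr => i _.
    by rewrite /U (unsplitK (inl i)).
  by rewrite /U (unsplitK (inr i)).
move=> [l l0 ->]; rewrite big_split_ord /=; eexists _, _; split; last by [].
  exists (fun i => l (lshift t i)) => //; apply: eq_bigr => i _.
  by rewrite /U (unsplitK (inl i)).
exists (fun i => l (rshift s i)) => //; apply: eq_bigr => i _.
by rewrite /U (unsplitK (inr i)).
Qed.

Lemma compatibleD (sg1 sg2 : set 'rV[R]_n) :
  compatible le sg1 -> compatible le sg2 ->
  compatible le [set v | exists x y, [/\ sg1 x, sg2 y & v = x + y]].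
Proof. by move=> h1 h2 v [x [y [/h1 hx /h2 hy ->]]]; exact: le_add_nneg. Qed.

Lemma is_cone_orthant : is_cone [set v : 'rV[R]_n | forall i, 0 <= v ord0 i].
Proof.
exists n, (fun i => delta_mx ord0 i).
have dE i : rvR (delta_mx ord0 i) = delta_mx ord0 i by rewrite /Defs.rvR map_delta_mx.
apply/seteqP; split=> v /=.
  move=> v0; exists (fun i => v ord0 i) => //.
  by rewrite [LHS]row_sum_delta; apply: eq_bigr => i _; rewrite dE.
move=> [l l0 ->] i; rewrite summxE sumr_ge0 // => j _.
by rewrite dE !mxE mulr_ge0.
Qed.

Lemma compatible_orthant :
  compatible le [set v : 'rV[R]_n | forall i, 0 <= v ord0 i].
Proof. by move=> v; exact: ole_orthant. Qed.

Lemma rep_up k l m p S : (0 < k)%N -> (0 < l)%N ->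
  (forall i, l%:Z * m ord0 i <= p ord0 i) -> rep k m S -> rep (k * l) p S.
Proof.
move=> k0 l0 mp [sg [h1 h2 h3]].
exists [set v | exists x (y : 'rV[R]_n), [/\ sg x, (forall i, 0 <= y ord0 i) & v = x + y]].
split; [exact: is_coneD is_cone_orthant|exact: compatibleD compatible_orthant|].
move=> g /h3 [hs hl].
have E : shiftq (k * l) p = shiftq k m + shiftq (k * l) (p - l%:Z *: m).
  have -> : shiftq k m = shiftq (k * l) (l%:Z *: m).
    apply/rowP => i; rewrite !mxE intrM natrM invfM -pmulrn mulrA mulfVK //.
    by rewrite pnatr_eq0 -lt0n.
  by rewrite /shiftq -scalerDr -map_mxD addrC subrK.
rewrite E addrA; split.
  rewrite rvRD; eexists _, _; split; [exact: hs| |by []].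
  move=> i; rewrite !mxE -(rmorph0 (ratr : rat -> R)) ler_rat mulr_ge0 ?invr_ge0 ?ler0n //.
  by rewrite ler0z subr_ge0.
apply: latticeD; first exact: lattice_mul.
by eexists.
Qed.

(* A common denominator and a common shift for two supports. *)
Lemma rep2 S T : lpset S -> lpset T ->
  exists k m, [/\ (0 < k)%N, rep k m S & rep k m T].
Proof.
move=> [k [m [k0 rS]]] [l [p [l0 rT]]].
pose q : 'rV[int]_n := \row_i (`|l%:Z * m ord0 i| + `|k%:Z * p ord0 i|).
exists (k * l)%N, q; split; first by rewrite muln_gt0 k0.
  by apply: rep_up rS => // i; rewrite mxE ler_wpDr // ler_norm.
by rewrite mulnC; apply: rep_up rT => // i; rewrite mxE ler_wpDl // ler_norm.
Qed.

Lemma lpsetU S T : lpset S -> lpset T -> lpset (S `|` T).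
Proof.
move=> hS hT; have [k [m [k0 [sg [h1 h2 h3]] [sg' [h1' h2' h3']]]]] := rep2 hS hT.
exists k, m; split=> //.
exists [set v | exists x y, [/\ sg x, sg' y & v = x + y]].
split; [exact: is_coneD|exact: compatibleD|].
have sg0 : sg 0 by case: h1 => [s [u ->]]; exact: cone0.
have sg0' : sg' 0 by case: h1' => [s [u ->]]; exact: cone0.
move=> g [/h3[hs hl]|/h3'[hs hl]]; split=> //.
  by eexists _, 0; split; [exact: hs| |rewrite addr0].
by eexists 0, _; split; [|exact: hs|rewrite add0r].
Qed.

Definition sumset S T : set 'rV[rat]_n := [set g | exists2 x, S x & T (g - x)].

Lemma lpsetD S T : lpset S -> lpset T -> lpset (sumset S T).
Proof.
move=> hS hT; have [k [m [k0 [sg [h1 h2 h3]] [sg' [h1' h2' h3']]]]] := rep2 hS hT.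
exists k, (m + m); split=> //.
exists [set v | exists x y, [/\ sg x, sg' y & v = x + y]].
split; [exact: is_coneD|exact: compatibleD|].
move=> g [x /h3[xs xl] /h3'[ys yl]].
have -> : g + shiftq k (m + m) = (x + shiftq k m) + (g - x + shiftq k m).
  by rewrite /shiftq map_mxD scalerDr addrACA [x + _]addrC subrK.
split; last exact: latticeD.
by rewrite rvRD; eexists _, _; split; [exact: xs|exact: ys|].
Qed.

Lemma lpset0 : lpset [set 0].
Proof.
exists 1%N, 0; split=> //; exists [set v | forall i, 0 <= v ord0 i].
split; [exact: is_cone_orthant|exact: compatible_orthant|].
move=> _ ->; rewrite /shiftq map_mx0 scaler0 addr0; split; last exact: lattice0.
by rewrite rvR0 => i; rewrite mxE.
Qed.

Lemma lpset_fin S T g : lpset S -> lpset T ->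
  finite_set [set d | S d /\ T (g - d)].
Proof.
move=> /lpset_wo wS /lpset_wo wT; apply: (@wo_wo_finite _ _ le _ g).
  by apply: wo_sub wS => ? [].
by apply: wo_sub wT => _ [d [_ Td] <-].
Qed.

End LatticeSets.

Section LPuiseux.
Variables (K : fieldType) (R : realType) (n : nat) (le : orthant_order R n).
Implicit Types (a b c : 'rV[rat]_n -> K).
Local Notation lp a := (lpset le (supp a)).

Lemma Kfrac_starP a : Kfrac_star le a <-> lp a.
Proof.
split=> [[k [k0 [m [sg [h1 h2 h3]]]]]|[k [m [k0 [sg [h1 h2 h3]]]]]].
  exists k, m; split=> //; exists sg; split=> // g ag; apply: h3.
  by rewrite /supp /mulX /= addrK.
exists k; split=> //; exists m, sg; split=> // g; rewrite /supp /mulX /=.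
by move/h3; rewrite subrK.
Qed.

Lemma Kpow_Kle a : Kpow a -> Kle le 1 a.
Proof.
move=> h; exists [set v | forall i, 0 <= v ord0 i]; split.
- exact: is_cone_orthant.
- exact: compatible_orthant.
move=> g /h [gl g0]; split=> // i.
by rewrite mxE -(rmorph0 (ratr : rat -> R)) ler_rat.
Qed.

Lemma lp_add a b : lp a -> lp b -> lp (fun g => a g + b g).
Proof.
move=> ha hb; apply: lpset_sub (lpsetU ha hb) => g /= ab.
apply/orP; apply: contraNT ab; rewrite negb_or !negbK => /andP[/eqP-> /eqP->].
by rewrite addr0.
Qed.

Lemma lp_opp a : lp a -> lp (fun g => - a g).
Proof. by apply: lpset_sub => g /=; rewrite /supp /= oppr_eq0. Qed.

Lemma lp_const (x : K) : lp (@constS K n x).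
Proof.
apply: lpset_sub (lpset0 le) => g; rewrite /supp /constS /=.
by case: (eqVneq g 0) => // _; rewrite eqxx.
Qed.

Lemma mulS_fset (X : {fset 'rV[rat]_n}) a b g :
  (forall d, a d != 0 -> b (g - d) != 0 -> d \in X) ->
  mulS a b g = \sum_(d <- X) a d * b (g - d).
Proof.
move=> h; apply: fsbigTE => d; apply: contraNeq.
by rewrite mulf_eq0 negb_or => /andP[]; exact: h.
Qed.

Lemma mulS_shift e a b g :
  mulS a b g = \sum_(d \in [set: 'rV[rat]_n]) a (d - e) * b (g + e - d).
Proof.
rewrite /mulS (reindex_fsbigT (fun d => d - e)); last first.
  by exists (fun d => d + e) => d; rewrite ?subrK ?addrK.
by apply: eq_fsbigr => d _; rewrite opprB addrA [g + e - d]addrAC [g - d + e]addrAC.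
Qed.

Lemma mulSC a b : mulS a b = mulS b a.
Proof.
apply/funext => g; rewrite /mulS (reindex_fsbigT (fun d => g - d)); last first.
  by exists (fun d => g - d) => d; rewrite subKr.
by apply: eq_fsbigr => d _; rewrite subKr mulrC.
Qed.

Lemma supp_mulS a b : supp (mulS a b) `<=` sumset (supp a) (supp b).
Proof.
move=> g; rewrite /supp /= => abg; apply: contrapT => h.
move/eqP: abg; apply; apply: fsbig1 => d _; apply/eqP.
apply/negPn/negP; rewrite mulf_eq0 negb_or => /andP[ad bd].
by apply: h; exists d.
Qed.

Lemma lp_mul a b : lp a -> lp b -> lp (mulS a b).
Proof. by move=> ha hb; apply: lpset_sub (lpsetD ha hb); exact: supp_mulS. Qed.

Lemma fin_fset (P : set 'rV[rat]_n) : finite_set P ->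
  exists X : {fset 'rV[rat]_n}, forall d, P d -> d \in X.
Proof. by move=> /finite_fsetP[X ->]; exists X. Qed.

Lemma mulSA a b c : lp a -> lp b -> lp c ->
  mulS a (mulS b c) = mulS (mulS a b) c.
Proof.
move=> ha hb hc; apply/funext => g.
have [X hX] := fin_fset (lpset_fin g ha (lpsetD hb hc)).
have [Y hY] := fin_fset (lpset_fin g (lpsetD ha hb) hc).
rewrite (@mulS_fset X); last first.
  by move=> d ad bcd; apply: hX; split=> //; exact: supp_mulS.
rewrite (@mulS_fset Y); last first.
  by move=> d abd cd; apply: hY; split=> //; exact: supp_mulS.
transitivity (\sum_(x <- X) \sum_(y <- Y) a x * (b (y - x) * c (g - y))).
  apply: eq_bigr => x _; have [->|ax] := eqVneq (a x) 0.
    by rewrite mul0r big1 // => y _; rewrite mul0r.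
  rewrite -mulr_sumr; congr (_ * _); rewrite (mulS_shift x) subrK.
  apply: fsbigTE => y; apply: contraNeq.
  rewrite mulf_eq0 negb_or => /andP[by_ cy]; apply: hY; split=> //.
  by exists x.
rewrite exchange_big /=; apply: eq_bigr => y _.
have [->|cy] := eqVneq (c (g - y)) 0.
  by rewrite mulr0 big1 // => x _; rewrite !mulr0.
rewrite (@mulS_fset X); last first.
  move=> x ax bx; apply: hX; split=> //; exists (y - x) => //.
  by rewrite /supp /= opprB addrA subrK.
by rewrite mulr_suml; apply: eq_bigr => x _; rewrite mulrA.
Qed.

Lemma mulSDl a b c : lp a -> lp b -> lp c ->
  mulS (fun g => a g + b g) c = (fun g => mulS a c g + mulS b c g).
Proof.
move=> ha hb hc; apply/funext => g.
have [X hX] := fin_fset (lpset_fin g (lpsetU ha hb) hc).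
rewrite !(@mulS_fset X).
- by rewrite -big_split; apply: eq_bigr => d _; rewrite mulrDl.
- by move=> d bd cd; apply: hX; split=> //; right.
- by move=> d ad cd; apply: hX; split=> //; left.
move=> d abd cd; apply: hX; split=> //; apply/orP; apply: contraNT abd.
by rewrite negb_or !negbK => /andP[/eqP-> /eqP->]; rewrite addr0.
Qed.

Lemma mulS1 a : mulS (@constS K n 1) a = a.
Proof.
apply/funext => g; rewrite (@mulS_fset [fset 0]%fset).
  by rewrite big_seq_fset1 /constS eqxx mul1r subr0.
by move=> d; rewrite /constS; case: (eqVneq d 0) => [->|_]; rewrite ?inE eqxx.
Qed.

End LPuiseux.

(* The elements of K_le((X^* )). *)
Record lpuiseux (K : fieldType) (R : realType) (n : nat)
    (le : orthant_order R n) := LPuiseux {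
  coeff :> 'rV[rat]_n -> K;
  coeffP : Kfrac_star le coeff
}.

Section LPuiseuxRing.
Variables (K : fieldType) (R : realType) (n : nat) (le : orthant_order R n).
Local Notation L := (lpuiseux K le).
Implicit Types phi psi chi : L.

Lemma lpuiseux_eq phi psi : (phi : _ -> _) = psi -> phi = psi.
Proof.
case: phi psi => [a ha] [b hb] /= ab.
by case: _ / ab hb => hb; congr LPuiseux; exact: Prop_irrelevance.
Qed.

Lemma coeff_lp phi : lpset le (supp phi).
Proof. exact/Kfrac_starP/coeffP. Qed.

Definition mkL (a : 'rV[rat]_n -> K) (ha : lpset le (supp a)) : L :=
  LPuiseux (proj2 (Kfrac_starP le a) ha).

Definition constL (x : K) : L := mkL (lp_const le x).
Definition addL phi psi : L := mkL (lp_add (coeff_lp phi) (coeff_lp psi)).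
Definition oppL phi : L := mkL (lp_opp (coeff_lp phi)).
Definition mulL phi psi : L := mkL (lp_mul (coeff_lp phi) (coeff_lp psi)).

HB.instance Definition _ := gen_eqMixin L.
HB.instance Definition _ := gen_choiceMixin L.

Lemma addLA : associative addL.
Proof. by move=> x y z; apply/lpuiseux_eq/funext => g; rewrite /= addrA. Qed.
Lemma addLC : commutative addL.
Proof. by move=> x y; apply/lpuiseux_eq/funext => g; rewrite /= addrC. Qed.
Lemma add0L : left_id (constL 0) addL.
Proof.
by move=> x; apply/lpuiseux_eq/funext => g; rewrite /= /constS if_same add0r.
Qed.
Lemma addNL : left_inverse (constL 0) oppL addL.
Proof.
by move=> x; apply/lpuiseux_eq/funext => g; rewrite /= /constS if_same addNr.
Qed.

HB.instance Definition _ := GRing.isZmodule.Build L addLA addLC add0L addNL.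

Lemma mulLA : associative mulL.
Proof.
move=> x y z; apply/lpuiseux_eq/(mulSA (coeff_lp x) (coeff_lp y) (coeff_lp z)).
Qed.
Lemma mulLC : commutative mulL.
Proof. by move=> x y; apply/lpuiseux_eq/mulSC. Qed.
Lemma mul1L : left_id (constL 1) mulL.
Proof. by move=> x; apply/lpuiseux_eq/mulS1. Qed.
Lemma mulLDl : left_distributive mulL addL.
Proof.
move=> x y z; apply/lpuiseux_eq/(mulSDl (coeff_lp x) (coeff_lp y) (coeff_lp z)).
Qed.
Lemma oneL_neq0 : constL 1 != constL 0.
Proof.
apply/eqP => /(congr1 (fun phi : L => phi 0)).
by rewrite /= /constS eqxx => /eqP; rewrite oner_eq0.
Qed.

HB.instance Definition _ :=
  GRing.Zmodule_isComNzRing.Build L mulLA mulLC mul1L mulLDl oneL_neq0.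

Lemma coeff0 g : (0 : L) g = 0.
Proof. by rewrite /= /constS if_same. Qed.
Lemma coeff1 g : (1 : L) g = (g == 0)%:R.
Proof. by rewrite /= /constS; case: eqP. Qed.
Lemma coeffD phi psi g : (phi + psi) g = phi g + psi g.
Proof. by []. Qed.
Lemma coeffN phi g : (- phi) g = - phi g.
Proof. by []. Qed.
Lemma coeffM phi psi g :
  (phi * psi) g = \sum_(d \in [set: 'rV[rat]_n]) phi d * psi (g - d).
Proof. by []. Qed.

End LPuiseuxRing.

Section Notions.
Variables (K : fieldType) (R : realType) (n : nat) (le : orthant_order R n).
Local Notation L := (lpuiseux K le).

(* K[[X]], K_le[[X]], K_le((X)) and K_le[[X^*]] inside K_le((X^* )). *)
Definition inKpow : {pred L} := fun phi => `[< Kpow phi >].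
Definition inKle : {pred L} := fun phi => `[< Kle le 1 phi >].
Definition inKfrac : {pred L} := fun phi => `[< Kfrac le 1 phi >].
Definition inKle_star : {pred L} := fun phi => `[< Kle_star le phi >].

(* nu_le(phi) = min_le Supp(phi); the default 0 is only taken at phi = 0 *)
Definition nu (phi : L) : 'rV[rat]_n :=
  xget 0 [set g | supp phi g /\ forall d, supp phi d -> le (rvR R g) (rvR R d)].

Lemma nuP (phi : L) : phi != 0 ->
  supp phi (nu phi) /\ forall d, supp phi d -> le (rvR R (nu phi)) (rvR R d).
Proof.
move=> phi0; apply: (@xgetPex _ 0 [set g | supp phi g /\ _]).
have [||g pg gmin] := lpset_wo (coeff_lp phi) (T := supp phi); first by [].
  apply/set0P; apply: contra_neq phi0 => s0; apply/lpuiseux_eq/funext => g.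
  rewrite coeff0; apply/eqP/negPn/negP => pg.
  by have : supp phi g by []; rewrite s0.
by exists g.
Qed.

(* the ideal (y - xi) of K_le((X^* ))[y] *)
Definition root_ideal (xi : L) : set {poly L} :=
  [set h | exists q : {poly L}, h = q * ('X - xi%:P)].

Definition Gamma (xi : L) (A : {pred L}) : set 'rV[rat]_n :=
  [set nu h.[xi] | h in [set h | h \is a polyOver A /\ ~ root_ideal xi h]].

(* Divisibility, units and irreducible elements of the ring S[y], for a subring S. *)
Definition divides_over (S : {pred L}) (g f : {poly L}) : Prop :=
  exists2 q : {poly L}, q \is a polyOver S & f = q * g.

Definition unit_over (S : {pred L}) (p : {poly L}) : Prop :=
  p \is a polyOver S /\ divides_over S p 1.

Definition irreducible_over (S : {pred L}) (g : {poly L}) : Prop :=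
  [/\ g \is a polyOver S, g != 0, ~ unit_over S g &
   forall p q : {poly L}, p \is a polyOver S -> q \is a polyOver S ->
     g = p * q -> unit_over S p \/ unit_over S q].

Definition is_branch (f : {poly L}) (B : set L) : Prop :=
  exists g : {poly L},
    [/\ irreducible_over inKle g, divides_over inKle g f &
     B = [set xi | xi \in inKle_star /\ root g xi]].

End Notions.

(* Main.v *)
Require Import Defs.
From HB Require Import structures.
From mathcomp Require Import all_boot all_order all_algebra.
From mathcomp Require Import finmap.
From mathcomp Require Import cyclic separable cyclotomic.
From mathcomp Require Import boolp classical_sets fsbigop reals.

Set Implicit Arguments.
Unset Strict Implicit.
Unset Printing Implicit Defensive.
Import Order.TTheory GRing.Theory Num.Theory.
Local Open Scope classical_set_scope.
Local Open Scope ring_scope.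

(** The theorem is Galois theory for the extension of K_le((X)) by the series
    with exponents in (1/k) Z^n.  A character chi of the finite group
    (1/k) Z^n / Z^n with values in the k-th roots of unity acts on such series by
    multiplying the coefficient of X^g by chi(g) ([twist]).  This is a ring
    automorphism that does not change supports, hence preserves nu, and that fixes
    every series with integral exponents, in particular the elements of A.  So
    h(chi . xi) = chi . h(xi) for h in A[y], and h(chi . xi) and h(xi) vanish
    together and have the same nu otherwise: xi and chi . xi have the same value
    set ([Gamma_twist]).

    It remains to see that two elements of one branch are related by a character
    ([branch_conjugate]).  Let m be the product of the y - eta over the distinct
    twists eta of xi ([orbit_poly]).  The twists permute these factors, so the
    coefficients of m are invariant under every character, and since the characters
    separate (1/k) Z^n / Z^n they have integral exponents; as xi lies in
    K_le[[X^(1/k)]], this puts m in K_le[[X]][y].  If g is the irreducible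
    polynomial of the branch, each twist of xi is a root of g, so m divides g; the
    quotient is again in K_le[[X]][y] because m is monic.  Now m is not a unit, as
    it has the root xi, so the quotient is one and has no root: every root of g is
    a root of m, that is a twist of xi.

    Working with an explicit orbit polynomial over the ring K_le[[X]] avoids
    minimal polynomials over the field K_le((X)) and any comparison between
    irreducibility over the ring and over the field. *)

(** * Roots of unity *)

Lemma prim_root_exists (F : closedFieldType) (m : nat) :
  [pchar F] =i pred0 -> (0 < m)%N -> exists w : F, m.-primitive_root w.
Proof.
move=> /pcharf0P F0 m0; pose p : {poly F} := 'X^m - 1.
have [r Dp] := closed_field_poly_normal p.
rewrite (monicP _) ?monicXnsubC // scale1r in Dp.
have rm1 : all m.-unity_root r by apply/allP=> z; rewrite -root_prod_XsubC -Dp.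
have sz_r : (m < (size r).+1)%N.
  by rewrite -(size_prod_XsubC r id) -Dp size_XnsubC.
have [|w] := hasP (has_prim_root m0 rm1 _ sz_r); last by exists w.
by rewrite -separable_prod_XsubC -Dp separable_Xn_sub_1 // F0 -lt0n.
Qed.

(** * Monic division and products of roots over a subring *)

Section PolyOver.
Variables (A : comNzRingType) (S : subringClosed A).

(** Since m is monic, the leading coefficient of q is that of q * m; subtracting
    the leading term of q leaves the same situation in lower degree. *)
Lemma polyOver_monic_quotient (q m : {poly A}) :
  m \is monic -> m \is a polyOver S -> q * m \is a polyOver S ->
  q \is a polyOver S.
Proof.
move=> m_mon Sm; move: {2}(size q) (leqnn (size q)) => d.
elim: d q => [|d IH] q.
  by rewrite leqn0 size_poly_eq0 => /eqP -> _; exact: rpred0.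
move=> sq Sqm; have [->|q0] := eqVneq q 0; first exact: rpred0.
have Sl : lead_coef q \in S.
  by rewrite -(lead_coef_Mmonic q m_mon) lead_coefE; exact: (polyOverP Sqm).
pose t := (lead_coef q)%:P * 'X^((size q).-1).
have St : t \is a polyOver S by rewrite rpredM ?polyOverC // rpredX ?polyOverX.
rewrite -(subrK t q) rpredD //; apply: IH; last first.
  by rewrite mulrBl rpredB // rpredM.
apply/leq_sizeP => j dj; rewrite /t coefB coefCM coefXn.
have [->|jq] := eqVneq j (size q).-1; first by rewrite mulr1 subrr.
rewrite mulr0 subr0 nth_default //.
have : (0 < size q)%N by rewrite size_poly_gt0.
case: (size q) jq sq => // s /= js; rewrite ltnS => sd _.
by rewrite ltn_neqAle eq_sym js (leq_trans sd).
Qed.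

(** Distinctness of the roots lets them be divided out one after the other: a root
    of (y - z) p' other than z is a root of p'.  Integrality is a hypothesis, to be
    supplied by [lpuiseux_integral], since the Puiseux series carry the structure
    of a commutative ring only. *)
Lemma prod_roots_divides (p : {poly A}) (s : seq A) :
  (forall x y : A, x * y = 0 -> x = 0 \/ y = 0) ->
  uniq s -> all (root p) s -> exists q, p = q * \prod_(z <- s) ('X - z%:P).
Proof.
move=> integral; elim: s p => [|z s IH] p /=.
  by move=> _ _; exists p; rewrite big_nil mulr1.
move=> /andP[zs us] /andP[/factor_theorem[p' ->] ps].
have [q ->] : exists q, p' = q * \prod_(z <- s) ('X - z%:P).
  apply: IH us _; apply/allP => x xs; have := allP ps x xs.
  rewrite !rootE hornerM hornerXsubC => /eqP/integral[->//|/eqP].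
  by rewrite subr_eq0 => /eqP xz; rewrite -xz xs in zs.
by exists q; rewrite big_cons [('X - _) * _]mulrC mulrA.
Qed.

Lemma root_prod_mem (s : seq A) (x : A) :
  (forall x y : A, x * y = 0 -> x = 0 \/ y = 0) ->
  root (\prod_(z <- s) ('X - z%:P)) x -> x \in s.
Proof.
move=> integral; elim: s => [|z s IH].
  by rewrite big_nil rootE hornerC oner_eq0.
rewrite big_cons rootE hornerM hornerXsubC inE => /eqP/integral[/eqP|/eqP].
  by rewrite subr_eq0 => ->.
by move/IH => ->; rewrite orbT.
Qed.

End PolyOver.

(** * Subrings of the Puiseux series *)

Section Subrings.
Variables (K : fieldType) (R : realType) (n : nat) (le : orthant_order R n).
Local Notation L := (lpuiseux K le).
Implicit Types (phi psi : L) (k : nat).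

(** The least exponents add up: the coefficient of the product at
    nu phi + nu psi is the product of the two lowest coefficients. *)
Lemma lpuiseux_integral phi psi : phi * psi = 0 -> phi = 0 \/ psi = 0.
Proof.
move=> pq0; have [->|p0] := eqVneq phi 0; first by left.
have [->|q0] := eqVneq psi 0; first by right.
have [ap pmin] := nuP p0; have [aq qmin] := nuP q0.
have := congr1 (fun x : L => x (nu phi + nu psi)) pq0.
rewrite coeff0 coeffM -/(mulS _ _ _) (@mulS_fset _ _ [fset (nu phi)]%fset).
  rewrite big_seq_fset1 addrC addrA addNr add0r => /eqP.
  by rewrite mulf_eq0 (negbTE ap) (negbTE aq).
move=> d pd qd; rewrite inE; apply/eqP.
apply: (@leQ_anti _ _ le); last exact: pmin.
have := leQ_add (d - nu psi) (qmin _ qd); rewrite /=.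
by rewrite [nu psi + _]addrC subrK addrA subrK addrK.
Qed.

Definition exponents_in k : {pred L} := fun phi => `[< supp phi `<=` lattice k >].

Lemma exponents_in_subring k : subring_closed (exponents_in k).
Proof.
split=> [|phi psi /asboolP p1 /asboolP p2|phi psi /asboolP p1 /asboolP p2];
  apply/asboolP.
- move=> g; rewrite /supp /mkset coeff1; have [->|_] := eqVneq g 0; last by rewrite eqxx.
  by move=> _; exact: lattice0.
- move=> g; rewrite /supp /mkset coeffD coeffN => pg.
  have [p0|] := eqVneq (phi g) 0; last exact: p1.
  by apply: p2; move: pg; rewrite p0 sub0r oppr_eq0.
- move=> g /supp_mulS[x /p1 x1 /p2 x2]; rewrite -[g](subrK x) addrC.
  exact: latticeD.
Qed.

HB.instance Definition _ k :=
  GRing.isSubringClosed.Build L (exponents_in k) (exponents_in_subring k).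

(** K_le[[X^(1/k)]] inside the Puiseux series; it is K_le[[X]] for k = 1. *)
Definition inKle_denom k : {pred L} := fun phi => `[< Kle le k phi >].

Lemma inKle_denom_subring k : subring_closed (inKle_denom k).
Proof.
have orth := is_cone_orthant R n; have corth := compatible_orthant le.
split=> [|phi psi /asboolP[s [s1 s2 s3]] /asboolP[t [t1 t2 t3]]|
  phi psi /asboolP[s [s1 s2 s3]] /asboolP[t [t1 t2 t3]]]; apply/asboolP.
- eexists; split; [exact: orth|exact: corth|].
  move=> g; rewrite /supp /mkset coeff1; have [->|_] := eqVneq g 0; last by rewrite eqxx.
  by move=> _; split; [rewrite rvR0 => i; rewrite mxE|exact: lattice0].
- eexists; split; [exact: is_coneD s1 t1|exact: compatibleD|].
  have s0 : s 0 by case: s1 => [? [? ->]]; exact: cone0.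
  have t0 : t 0 by case: t1 => [? [? ->]]; exact: cone0.
  move=> g; rewrite /supp /mkset coeffD coeffN => pg.
  have [p0|/s3[sg lg]] := eqVneq (phi g) 0.
    have /t3[tg lg] : supp psi g by move: pg; rewrite p0 sub0r oppr_eq0.
    by split=> //; exists 0, (rvR R g); rewrite add0r.
  by split=> //; exists (rvR R g), 0; rewrite addr0.
- eexists; split; [exact: is_coneD s1 t1|exact: compatibleD|].
  move=> g /supp_mulS[x /s3[x1 x2] /t3[x3 x4]]; rewrite -[g](subrK x) addrC.
  split; last exact: latticeD.
  exists (rvR R x), (rvR R (g - x)).
  by split; [exact: x1|exact: x3|exact: rvRD].
Qed.

HB.instance Definition _ k :=
  GRing.isSubringClosed.Build L (inKle_denom k) (inKle_denom_subring k).

Lemma inKle_denom_exponents k : {subset inKle_denom k <= exponents_in k}.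
Proof.
by move=> phi /asboolP[s [_ _ h]]; apply/asboolP => g /h[].
Qed.

Lemma inKle_denom_integral k phi :
  phi \in inKle_denom k -> phi \in exponents_in 1 -> phi \in inKle_denom 1.
Proof.
move=> /asboolP[s [s1 s2 s3]] /asboolP h; apply/asboolP; exists s; split=> //.
by move=> g pg; split; [case: (s3 g pg)|exact: h].
Qed.

Lemma exponents_in1 k : (0 < k)%N -> {subset exponents_in 1 <= exponents_in k}.
Proof.
move=> k0 phi /asboolP h; apply/asboolP => g /h; rewrite -[k]mul1n.
exact: lattice_mul.
Qed.

Lemma Kfrac_exponents : {subset @inKfrac K R n le <= exponents_in 1}.
Proof.
move=> phi /asboolP[m [s [_ _ h]]]; apply/asboolP => g pg.
have lm : lattice 1 (1%:R^-1 *: map_mx intr m : 'rV[rat]_n) by exists m.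
have [] := h (g + 1%:R^-1 *: map_mx intr m).
  by rewrite /supp /mkset /mulX addrK.
by move=> _ /latticeD/(_ (latticeN lm)); rewrite addrK.
Qed.

End Subrings.

(** * Twisting a series by a function on its exponents *)

Section Twist.
Variables (K : fieldType) (R : realType) (n : nat) (le : orthant_order R n).
Local Notation L := (lpuiseux K le).
Implicit Types (phi psi : L) (c : 'rV[rat]_n -> K).

(** Multiplying coefficients can only shrink the support, so any c gives a map on
    Puiseux series; multiplicativity on a lattice is imposed later, and makes it a
    ring morphism only on the series with exponents in that lattice. *)
Lemma lp_twist c phi : lpset le (supp (fun g => c g * phi g)).
Proof.
apply: lpset_sub (coeff_lp phi) => g; rewrite /supp /mkset mulf_eq0 negb_or.
by case/andP.
Qed.

Definition twist c phi : L := mkL (lp_twist c phi).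

Lemma twistE c phi g : twist c phi g = c g * phi g. Proof. by []. Qed.

Lemma twist_comp c d phi : twist c (twist d phi) = twist (fun g => c g * d g) phi.
Proof. by apply/lpuiseux_eq/funext => g; rewrite !twistE mulrA. Qed.

Lemma twist_is_additive c : additive (twist c).
Proof.
move=> phi psi; apply/lpuiseux_eq/funext => g.
by rewrite !(twistE, coeffD, coeffN) mulrBr.
Qed.

HB.instance Definition _ c :=
  GRing.isAdditive.Build L L (twist c) (twist_is_additive c).

Variables (k : nat) (c : 'rV[rat]_n -> K).
Hypothesis c_neq0 : forall g, c g != 0.

Lemma supp_twist phi : supp (twist c phi) = supp phi.
Proof.
apply/funext => g; apply/propext; rewrite /supp /mkset twistE mulf_eq0.
by rewrite (negbTE (c_neq0 g)).
Qed.

Lemma twist_inj : injective (twist c).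
Proof.
move=> phi psi e; apply/lpuiseux_eq/funext => g.
by apply: (mulfI (c_neq0 g)); rewrite -!twistE e.
Qed.

Lemma nu_twist phi : nu (twist c phi) = nu phi.
Proof. by rewrite /nu supp_twist. Qed.

Lemma inKle_denom_twist phi : (twist c phi \in inKle_denom k) = (phi \in inKle_denom k).
Proof. by apply/asboolP/asboolP; rewrite /Kle /Ksigma /mkset supp_twist. Qed.

Lemma exponents_in_twist phi :
  (twist c phi \in exponents_in k) = (phi \in exponents_in k).
Proof. by apply/asboolP/asboolP; rewrite supp_twist. Qed.

Hypothesis c_mult : forall g h, lattice k g -> lattice k h -> c (g + h) = c g * c h.

Lemma char_at0 : c 0 = 1.
Proof.
have := c_mult (lattice0 _ k) (lattice0 _ k); rewrite addr0 -{1}[c 0]mulr1.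
by move/(mulfI (c_neq0 0)).
Qed.

Lemma twist1 : twist c 1 = 1.
Proof.
apply/lpuiseux_eq/funext => g; rewrite twistE coeff1.
by case: eqP => [->|_]; rewrite ?char_at0 ?mulr1 ?mulr0.
Qed.

(** Only the exponents d and g - d that occur in phi and psi contribute to the
    coefficient at g, and c is multiplicative there. *)
Lemma twistM phi psi : phi \in exponents_in k -> psi \in exponents_in k ->
  twist c (phi * psi) = twist c phi * twist c psi.
Proof.
move=> /asboolP p1 /asboolP p2; apply/lpuiseux_eq/funext => g.
have [X hX] := fin_fset (lpset_fin g (coeff_lp phi) (coeff_lp psi)).
rewrite twistE !coeffM -!/(mulS _ _ _).
rewrite (mulS_fset (X := X)); last by move=> d pd qd; apply: hX.
rewrite (mulS_fset (X := X)); last first.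
  move=> d; rewrite !twistE !mulf_eq0 !negb_or => /andP[_ pd] /andP[_ qd].
  exact: hX.
rewrite mulr_sumr; apply: eq_bigr => d _; rewrite !twistE mulrACA.
have [->|pd] := eqVneq (phi d) 0; first by rewrite !(mul0r, mulr0).
have [->|qd] := eqVneq (psi (g - d)) 0; first by rewrite !(mul0r, mulr0).
by rewrite -c_mult ?(addrC d) ?subrK //; [exact: p1|exact: p2].
Qed.

Lemma twistX phi i : phi \in exponents_in k -> twist c (phi ^+ i) = twist c phi ^+ i.
Proof.
move=> p1; elim: i => [|i IH]; first by rewrite !expr0 twist1.
by rewrite !exprS twistM ?IH // rpredX.
Qed.

Lemma map_twistM (p q : {poly L}) :
  p \is a polyOver (exponents_in k) -> q \is a polyOver (exponents_in k) ->
  map_poly (twist c) (p * q) = map_poly (twist c) p * map_poly (twist c) q.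
Proof.
move=> /polyOverP Sp /polyOverP Sq; apply/polyP => i.
rewrite coef_map !coefM raddf_sum; apply: eq_bigr => j _ /=.
by rewrite !coef_map twistM.
Qed.

Lemma map_twist_prod (s : seq L) :
  {subset s <= exponents_in k} ->
  map_poly (twist c) (\prod_(z <- s) ('X - z%:P)) =
  \prod_(z <- s) ('X - (twist c z)%:P).
Proof.
elim: s => [|z s IH] Ss.
  by rewrite !big_nil map_polyC /= twist1.
have Ss' : {subset s <= exponents_in k} by move=> x xs; apply: Ss; rewrite inE xs orbT.
have Sz : z \in exponents_in k by apply: Ss; rewrite mem_head.
rewrite !big_cons map_twistM ?IH //.
- congr (_ * _); apply/polyP => i; rewrite coef_map !coefB !coefX !coefC raddfB /=.
  by congr (_ - _); case: eqP => _; rewrite ?twist1 ?raddf0.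
- by rewrite polyOverXsubC.
- rewrite big_seq; apply: rpred_prod => x xs; rewrite polyOverXsubC; exact: Ss'.
Qed.

Hypothesis k_gt0 : (0 < k)%N.
Hypothesis c_lattice1 : forall g, lattice 1 g -> c g = 1.

Lemma twist_exponents1 phi : phi \in exponents_in 1 -> twist c phi = phi.
Proof.
move=> /asboolP h; apply/lpuiseux_eq/funext => g; rewrite twistE.
by have [->|/h/c_lattice1->] := eqVneq (phi g) 0; rewrite ?mulr0 ?mul1r.
Qed.

(** The twist is a ring morphism on series with exponents in (1/k) Z^n and fixes
    those with integral exponents, hence commutes with polynomials over these. *)
Lemma twist_horner (p : {poly L}) phi :
  p \is a polyOver (exponents_in 1) -> phi \in exponents_in k ->
  twist c p.[phi] = p.[twist c phi].
Proof.
move=> /polyOverP Sp Sphi; rewrite !horner_coef raddf_sum; apply: eq_bigr => i _ /=.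
have pk : p`_i \in exponents_in k by apply: exponents_in1.
by rewrite twistM ?rpredX // twistX // twist_exponents1.
Qed.

End Twist.

(** * The characters of (1/k) Z^n / Z^n and the orbit polynomial *)

Section Characters.
Variables (K : fieldType) (R : realType) (n : nat) (le : orthant_order R n).
(* The denominator is k.+1, so that 'I_k.+1 is inhabited. *)
Variables (k : nat) (w : K).
Hypothesis w_prim : k.+1.-primitive_root w.
Local Notation L := (lpuiseux K le).
Local Notation lat := (lattice k.+1).
Implicit Types (e : {ffun 'I_n -> 'I_k.+1}) (g h : 'rV[rat]_n).

(** On the lattice this is the integer (k + 1) g_i; off the lattice the value is
    meaningless, and [char] is multiplicative only on the lattice. *)
Definition numer g (i : 'I_n) : int := numq (k.+1%:R * g ord0 i).
Definition char e g : K := w ^ (\sum_i (e i)%:Z * numer g i).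

Lemma w_neq0 : w != 0.
Proof.
apply/eqP => w0; have := prim_expr_order w_prim; rewrite w0 expr0n /= => /eqP.
by rewrite eq_sym oner_eq0.
Qed.

Lemma char_neq0 e g : char e g != 0.
Proof. by rewrite expfz_neq0 // w_neq0. Qed.

Lemma numerE g i : lat g -> (numer g i)%:~R = k.+1%:R * g ord0 i.
Proof.
move=> [m _ <-]; rewrite /numer !mxE mulVKf ?pnatr_eq0 //.
by rewrite numq_int.
Qed.

Lemma charD e g h : lat g -> lat h -> char e (g + h) = char e g * char e h.
Proof.
move=> lg lh; rewrite /char -expfzDr ?w_neq0 // -big_split /=; congr (_ ^ _).
apply: eq_bigr => i _; rewrite -mulrDr; congr (_ * _).
apply: (@intr_inj rat); rewrite intrD !numerE //; last exact: latticeD.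
by rewrite mxE mulrDr.
Qed.

Lemma expz_dvd (z : int) : (w ^ z == 1) = (k.+1%:Z %| z)%Z.
Proof.
rewrite dvdzE absz_nat (prim_order_dvd w_prim); case: z => m //=.
by rewrite NegzE -exprnN invr_eq1.
Qed.

Lemma char_lattice1 e g : lattice 1 g -> char e g = 1.
Proof.
move=> [m _ <-]; apply/eqP; rewrite /char expz_dvd.
apply: (big_ind (fun z : int => (k.+1%:Z %| z)%Z)) => [|x y|i _]; first exact: dvdz0.
  exact: rpredD.
apply: dvdz_mull; rewrite /numer !mxE invr1 mul1r -(intrM _ k.+1%:Z) numq_int.
exact: dvdz_mulr.
Qed.

(** The character given by the i-th basis vector sends g to w ^ ((k + 1) g_i),
    which is 1 only if g_i is an integer, w being a primitive (k + 1)-th root. *)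
Lemma char_separates g : lat g -> (forall e, char e g = 1) -> lattice 1 g.
Proof.
move=> lg c1.
(* In 'I_1 the entry 1 of the basis vector would be 0; k = 0 is treated apart. *)
have dv i : exists z : int, numer g i = z * k.+1%:Z.
  apply/dvdzP; have [k0|k0] := posnP k.
    by rewrite k0 dvd1z.
  have := c1 [ffun j => if j == i then inord 1 else ord0].
  rewrite /char (bigD1 i) //= big1 => [|j /negbTE ji]; last by rewrite ffunE ji mul0r.
  rewrite ffunE eqxx inordK // mul1r addr0 => /eqP; by rewrite expz_dvd.
have [z zE] := choice dv; exists (\row_i z i) => //.
apply/rowP => i; rewrite !mxE invr1 mul1r.
apply: (@mulfI _ k.+1%:R); first by rewrite pnatr_eq0.
by rewrite -numerE // zE mulrC intrM.
Qed.

Definition char_mul e e' : {ffun 'I_n -> 'I_k.+1} :=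
  [ffun i => inord ((e i + e' i) %% k.+1)].

Lemma char_mulE e e' g : char (char_mul e e') g = char e g * char e' g.
Proof.
have w0 := w_neq0; rewrite /char -expfzDr // -big_split /=.
rewrite !(big_morph (exprz w) (fun x y => expfzDr x y w0) (expr0z w)).
apply: eq_bigr => i _; rewrite ffunE inordK ?ltn_mod // -mulrDl -PoszD.
by rewrite -!exprz_exp -!exprnP prim_expr_mod.
Qed.

Definition conjugates (xi : L) : seq L :=
  undup [seq twist (char e) xi | e : {ffun 'I_n -> 'I_k.+1}].

Lemma mem_conjugates xi : xi \in conjugates xi.
Proof.
rewrite mem_undup; apply/mapP; exists [ffun=> ord0]; first by rewrite mem_enum.
apply/lpuiseux_eq/funext => g; rewrite twistE /char big1 ?mul1r // => i _.
by rewrite ffunE mul0r.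
Qed.

Lemma conjugatesP xi eta : eta \in conjugates xi -> exists e, eta = twist (char e) xi.
Proof. by rewrite mem_undup => /mapP[e _ ->]; exists e. Qed.

(** A twist is injective and maps the finite orbit into itself. *)
Lemma conjugates_perm e xi :
  perm_eq [seq twist (char e) z | z <- conjugates xi] (conjugates xi).
Proof.
have u : uniq [seq twist (char e) z | z <- conjugates xi].
  rewrite map_inj_uniq ?undup_uniq //; exact/twist_inj/char_neq0.
have sub : {subset [seq twist (char e) z | z <- conjugates xi] <= conjugates xi}.
  move=> _ /mapP[_ /conjugatesP[e' ->] ->].
  rewrite mem_undup twist_comp; apply/mapP; exists (char_mul e e').
    by rewrite mem_enum.
  by congr twist; apply/funext => g; rewrite char_mulE.
have szle : (size (conjugates xi) <=
             size [seq twist (char e) z | z <- conjugates xi])%N.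
  by rewrite size_map.
apply: (uniq_perm u); first exact: undup_uniq.
exact: (uniq_min_size u sub szle).2.
Qed.

Definition orbit_poly xi : {poly L} := \prod_(z <- conjugates xi) ('X - z%:P).

(** The coefficients lie in K_le[[X^(1/k)]] since the orbit does, and are fixed by
    all characters; as the characters separate the exponents, these are integral. *)
Lemma orbit_poly_over xi : xi \in inKle_denom k.+1 ->
  orbit_poly xi \is a polyOver (inKle_denom 1).
Proof.
move=> Exi; have Ec : {subset conjugates xi <= inKle_denom k.+1}.
  by move=> _ /conjugatesP[e ->]; rewrite inKle_denom_twist //; exact: char_neq0.
have Eo : orbit_poly xi \is a polyOver (inKle_denom k.+1).
  rewrite /orbit_poly big_seq; apply: rpred_prod => z /Ec; by rewrite polyOverXsubC.
apply/polyOverP => i; apply: (inKle_denom_integral (polyOverP Eo i)).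
apply/asboolP => g pg; apply: char_separates => [|e].
  by have /asboolP := inKle_denom_exponents (polyOverP Eo i); apply.
have inv : map_poly (twist (char e)) (orbit_poly xi) = orbit_poly xi.
  rewrite /orbit_poly (map_twist_prod (k := k.+1)).
  - by rewrite -[RHS](perm_big _ (conjugates_perm e xi)) big_map.
  - exact: char_neq0.
  - exact: charD.
  - move=> z /Ec. exact: inKle_denom_exponents.
have := congr1 (fun p : {poly L} => p`_i g) inv.
by rewrite coef_map /= => /(canRL (mulfK pg)); rewrite divff.
Qed.

End Characters.

(** * Value sets along a branch *)

Lemma root_idealE (K : fieldType) (R : realType) (n : nat) (le : orthant_order R n)
    (eta : lpuiseux K le) (h : {poly lpuiseux K le}) :
  root_ideal eta h <-> root h eta.
Proof.
by split=> [[q hq]|/factor_theorem[q hq]]; [apply/factor_theorem|]; exists q.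
Qed.

Lemma Gamma_twist (K : fieldType) (R : realType) (n : nat) (le : orthant_order R n)
    (k : nat) (c : 'rV[rat]_n -> K) (A : {pred lpuiseux K le}) (xi : lpuiseux K le) :
  (0 < k)%N -> (forall g, c g != 0) ->
  (forall g h, lattice k g -> lattice k h -> c (g + h) = c g * c h) ->
  (forall g, lattice 1 g -> c g = 1) ->
  {subset A <= @exponents_in K R n le 1} -> xi \in exponents_in k ->
  Gamma (twist c xi) A = Gamma xi A.
Proof.
move=> k0 c0 cM c1 A1 xik.
have E h : h \is a polyOver A -> h.[twist c xi] = twist c h.[xi].
  move=> /(polyOverS A1) h1; by rewrite (twist_horner (k := k)).
have I h : h \is a polyOver A -> (root_ideal (twist c xi) h <-> root_ideal xi h).
  move=> hA; rewrite !root_idealE !rootE E // -[in X in X <-> _](raddf0 (twist c)).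
  by rewrite (inj_eq (twist_inj c0)).
by apply/seteqP; split=> _ [h [hA hn] <-]; exists h;
  rewrite ?E ?nu_twist //; split=> //; move: hn; apply: contra_not => /(I h hA).
Qed.

(** The orbit polynomial of xi divides g over K_le[[X]] and is not a unit, so by
    irreducibility the other factor is a unit and contributes no root. *)
Lemma branch_conjugate (K : fieldType)
    (R : realType) (n : nat) (le : orthant_order R n) (k : nat) (w : K)
    (g : {poly lpuiseux K le}) (xi xi' : lpuiseux K le) :
  k.+1.-primitive_root w -> irreducible_over (@inKle K R n le) g ->
  xi \in inKle_denom k.+1 -> root g xi -> root g xi' ->
  xi' \in conjugates k w xi.
Proof.
move=> wP [Sg g0 _ irr] Exi gxi gxi'.
have Sm := orbit_poly_over wP Exi; set m := orbit_poly _ _ _ in Sm.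
have all_roots : all (root g) (conjugates k w xi).
  apply/allP => _ /conjugatesP[e ->]; rewrite rootE.
  rewrite -(twist_horner (k := k.+1)) //; last exact: inKle_denom_exponents.
  - by rewrite (eqP gxi) raddf0.
  - exact: char_neq0.
  - exact: charD.
  - exact: char_lattice1.
  - by apply: polyOverS Sg => phi; exact: inKle_denom_exponents.
have [q gE] := prod_roots_divides (@lpuiseux_integral K R n le) (undup_uniq _) all_roots.
have Sq : q \is a polyOver (inKle_denom 1).
  apply: (@polyOver_monic_quotient _ _ q m) => //; first exact: monic_prod_XsubC.
  by rewrite -gE.
have not_root p eta : unit_over (@inKle K R n le) p -> root p eta -> False.
  move=> [_ [r _ r1]] /eqP pe; have := hornerC 1 eta.
  by rewrite [1%:P]r1 hornerM pe mulr0 => /eqP; rewrite eq_sym oner_eq0.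
have [/not_root qU|/not_root mU] := irr _ _ Sq Sm gE; last first.
  have [] := mU xi; rewrite /m /orbit_poly (big_rem _ (mem_conjugates k w xi)) /=.
  by rewrite rootE hornerM hornerXsubC subrr mul0r.
apply: (root_prod_mem (@lpuiseux_integral K R n le)).
move: gxi'; rewrite rootE gE hornerM => /eqP/lpuiseux_integral[/eqP/qU//|/eqP].
by [].
Qed.

Theorem theorem7 (K : closedFieldType) (charK : [pchar K] =i pred0)
    (R : realType) (n : nat) (n_ge1 : (1 <= n)%N) (le : orthant_order R n)
    (f : {poly lpuiseux K le})
    (f_pow : f \is a polyOver (@inKpow K R n le)) (f_monic : f \is monic)
    (A : {pred lpuiseux K le})
    (A_subring : subring_closed A)
    (A_frac : {subset A <= @inKfrac K R n le})
    (xi xi' : lpuiseux K le) (f_xi : root f xi) (f_xi' : root f xi')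
    (same_branch : exists B : set (lpuiseux K le),
       [/\ is_branch f B, B xi & B xi']) :
  Gamma xi A = Gamma xi' A.
Proof.
have [_ [[g [g_irr _ ->]] [/asboolP[k [k_gt0 xi_k]] g_xi] [_ g_xi']]] := same_branch.
case: k k_gt0 xi_k => // k _ xi_k.
have Exi : xi \in inKle_denom k.+1 by apply/asboolP.
have [w wP] := prim_root_exists charK (ltn0Sn k).
have /conjugatesP[e ->] := branch_conjugate wP g_irr Exi g_xi g_xi'.
symmetry; apply: (@Gamma_twist _ _ _ _ k.+1) => //.
- exact: char_neq0.
- exact: charD.
- exact: char_lattice1.
- by move=> phi /A_frac /Kfrac_exponents.
- exact: inKle_denom_exponents.
Qed.
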